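(* Consider a prediction space $(\Omega,\mathcal{A},\mathbb{Q})$ with a binary outcome $Y$, where $Y=0$ corresponds to a success and $Y=1$ to a failure, and a CDF-valued random quantity $F(y)=p\,\mathbb{1}(y\ge 0)+(1-p)\,\mathbb{1}(y\ge 1)$, $y\in\mathbb{R}$, which can be identified with the random probability forecast $p\in[0,1]$ for a success. Then the following statements are equivalent: (i) The forecast $F$ is probabilistically calibrated, that is, its probability integral transform $Z_F$ is uniformly distributed on the unit interval. (ii) The probability forecast $p$ is conditionally calibrated, that is, $\mathbb{Q}(Y=0\mid p)=p$ almost surely. (iii) The forecast $F$ is ideal relative to the $\sigma$-algebra $\sigma(p)$ generated by the probability forecast $p$.
   Context: A prediction space (here with a single forecast) is a probability space $(\Omega,\mathcal{A},\mathbb{Q})$ with a sub-$\sigma$-algebra $\mathcal{A}_1\subseteq\mathcal{A}$ carrying: a random right-continuous cumulative distribution function (CDF) $F$ on $\mathbb{R}$ that is $\mathcal{A}_1$-measurable (i.e. $F(x)$ is $\mathcal{A}_1$-measurable for each $x\in\mathbb{R}$); a real-valued random variable $Y$ (the observation); and a random variable $V$ uniformly distributed on the unit interval and independent of $\mathcal{A}_1$ and $Y$ (jointly). ''Almost surely'' refers to $\mathbb{Q}$. The probability integral transform of $F$ is the random variable $Z_F=\lim_{y\uparrow Y}F(y)+V\bigl(F(Y)-\lim_{y\uparrow Y}F(y)\bigr)$. $F$ is ideal relative to a sub-$\sigma$-algebra $\mathcal{A}_0$ if $F=\mathcal{L}(Y\mid\mathcal{A}_0)$ almost surely, i.e. $F(y)=\mathbb{Q}(Y\le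 y\mid\mathcal{A}_0)$ almost surely for all $y\in\mathbb{R}$. ''Binary'' means $Y\in\{0,1\}$; $\mathbb{1}$ denotes an indicator. *)

(* Defs.v *)
From HB Require Import structures.
From mathcomp Require Import all_boot all_order all_algebra.
From mathcomp Require Import all_classical all_reals all_analysis.
Import Order.TTheory GRing.Theory Num.Theory.
Import numFieldNormedType.Exports.

Set Implicit Arguments.
Unset Strict Implicit.
Unset Printing Implicit Defensive.

Local Open Scope classical_set_scope.
Local Open Scope ring_scope.

Definition is_cdf (R : realType) (f : R -> R) : Prop :=
  [/\ nondecreasing f, right_continuous f,
      f x @[x --> -oo] --> (0 : R) & f x @[x --> +oo] --> (1 : R)].

Definition sub_sigma_algebra_of d (T : measurableType d) (A0 : set (set T)) :
    Prop :=
  sigma_algebra setT A0 /\ A0 `<=` measurable.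

Definition measurable_wrt d (T : measurableType d) (R : realType)
    (A0 : set (set T)) (f : T -> R) : Prop :=
  g_sigma_algebra_preimage f `<=` A0.

Definition uniform01 d (T : measurableType d) (R : realType)
    (P : probability T R) (X : T -> R) : Prop :=
  measurable_fun setT X /\
  forall B : set R, measurable B ->
    P (X @^-1` B) = uniform_prob (@ltr01 R) B.

Definition independent_sigma d (T : measurableType d) (R : realType)
    (P : probability T R) (G H : set (set T)) : Prop :=
  forall A B, G A -> H B -> P (A `&` B) = (P A * P B)%E.

Record prediction_space d (T : measurableType d) (R : realType)
    (P : probability T R) (A1 : set (set T)) (F : T -> R -> R)
    (Y V : {RV P >-> R}) : Prop := PredictionSpace {
  ps_sub : sub_sigma_algebra_of A1 ;
  ps_cdf : forall w, is_cdf (F w) ;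
  ps_meas : forall x, measurable_wrt A1 (fun w => F w x) ;
  ps_unif : uniform01 P V ;
  ps_indep : independent_sigma P (g_sigma_algebra_preimage V)
               <<s A1 `|` g_sigma_algebra_preimage Y >> }.

Definition pit d (T : measurableType d) (R : realType) (F : T -> R -> R)
    (Y V : T -> R) (w : T) : R :=
  let Fleft := lim (F w y @[y --> (Y w)^'-]) in
  Fleft + V w * (F w (Y w) - Fleft).

Definition probabilistically_calibrated d (T : measurableType d)
    (R : realType) (P : probability T R) (F : T -> R -> R) (Y V : T -> R) :
    Prop :=
  uniform01 P (pit F Y V).

(* g is a version of the conditional probability P(E | A0). *)
Definition is_cond_prob d (T : measurableType d) (R : realType)
    (P : probability T R) (A0 : set (set T)) (E : set T) (g : T -> R) : Prop :=
  [/\ measurable_wrt A0 g,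
      P.-integrable setT (EFin \o g) &
      forall A, A0 A -> (\int[P]_(w in A) (g w)%:E)%E = P (E `&` A)].

(* P(E | A0) = f almost surely. Versions of P(E | A0) are unique up to P-null
   sets, so it does not matter which one is compared with f. *)
Definition cond_prob_ae_eq d (T : measurableType d) (R : realType)
    (P : probability T R) (A0 : set (set T)) (E : set T) (f : T -> R) : Prop :=
  exists2 g, is_cond_prob P A0 E g & {ae P, forall w, g w = f w}.

Definition ideal d (T : measurableType d) (R : realType) (P : probability T R)
    (A0 : set (set T)) (F : T -> R -> R) (Y : T -> R) : Prop :=
  forall y, cond_prob_ae_eq P A0 [set w | Y w <= y] (fun w => F w y).

Definition conditionally_calibrated d (T : measurableType d) (R : realType)
    (P : probability T R) (p Y : T -> R) : Prop :=
  cond_prob_ae_eq P (g_sigma_algebra_preimage p) [set w | Y w = 0] p.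

Definition binary_cdf (R : realType) (p : R) : R -> R :=
  fun y => p * \1_[set t : R | 0 <= t] y + (1 - p) * \1_[set t : R | 1 <= t] y.

(* Main.v *)
Require Import Defs.
From HB Require Import structures.
From mathcomp Require Import all_boot all_order all_algebra finmap.
From mathcomp Require Import all_classical all_reals all_analysis.
From mathcomp Require Import measurable_realfun ring lra.
Import Order.TTheory GRing.Theory Num.Theory.
Import numFieldNormedType.Exports.

(** The equivalence of conditional calibration and ideality relative to
    sigma(p) holds because the binary CDF takes only the values 0, p and 1:
    for y < 0 and y >= 1 the event {Y <= y} is trivial, and for 0 <= y < 1 it is
    {Y = 0} while F(y) = p.

    The content is the equivalence with probabilistic calibration. Write
    D = 1 - Y - p for the residual of the forecast. Conditional calibration says
    that D has mean zero on every event {p in B} (conditionally_calibratedP).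
    The transform is Z = V p on {Y = 0} and Z = p + V (1 - p) on {Y = 1}, so
    for fixed z in [0, 1[ and V in ]0, 1] the inequality Z <= z reads V <= U
    for a threshold U in [0, 1] that depends on p and Y only. As V is uniform
    and independent of U, P(Z <= z) = E[U]. The threshold is affine in the
    residual: U = z + k_z(p) D, where k_z (pit_kernel) is (1 - z) / (1 - x) for
    x <= z and z / x for x > z. Hence (pit_cdf)

      P(Z <= z) = z + E[k_z(p) D],

    and probabilistic calibration says that E[k_z(p) D] = 0 for all z in [0, 1[
    (probabilistically_calibratedP). Each k_z is bounded and measurable, so this
    follows from conditional calibration (Borel_moments_pit_kernel).

    Conversely (pit_kernel_moments_Borel), x (1 - x) k_z(x) = min(x, z) - x z
    is, up to sign, the Green function of the second derivative on [0, 1], so the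
    kernels determine everything. Concretely, the difference quotients of k_z in
    z stay bounded and converge to the derivative h_c of k_z at z = c
    (pit_kernel_slope), so E[h_c(p) D] = 0. Both k_c and h_c are multiples of
    1 / (1 - x) for x <= c and of 1 / x for x > c, and their combinations
    isolate either side. Since k_{1/2} is also a multiple of these functions on
    the two halves of [0, 1], every 1_{x > c} k_{1/2}(x) is a combination of
    kernels and slopes. A pi-lambda argument extends
    E[1_{p > c} k_{1/2}(p) D] = 0 from rays to Borel sets, and the factor
    k_{1/2}, which is at least 1/2 on [0, 1], can be divided out. *)

Set Implicit Arguments.
Unset Strict Implicit.
Unset Printing Implicit Defensive.

Local Open Scope classical_set_scope.
Local Open Scope ring_scope.

(** * Vanishing integrals of bounded functions *)

Lemma measurable_funV (R : realType) : measurable_fun setT (@GRing.inv R).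
Proof.
have -> : @GRing.inv R = (fun x => if x == 0 then 0 else x^-1).
  by apply/funext => x; case: eqP => // ->; rewrite invr0.
apply: measurable_fun_if => //.
  exact: measurable_fun_eqr.
rewrite setTI; apply: open_continuous_measurable_fun.
  rewrite (_ : _ @^-1` _ = ~` [set 0]).
    by apply: closed_openC; exact: closed_eq.
  by apply/seteqP; split => x /=; case: (x =P 0).
move=> x; rewrite inE/= => x0.
by apply: inv_continuous; rewrite x0.
Qed.

Section bounded_functions.
Context d (T : measurableType d) (R : realType) (P : probability T R).
Implicit Types (f g : T -> R) (M : R).

Lemma bounded_integrable f M : measurable_fun setT f ->
  (forall w, `|f w| <= M) -> P.-integrable setT (EFin \o f).
Proof.
move=> mf fM; apply: measurable_bounded_integrable => //.
  by apply: (le_lt_trans (probability_le1 P measurableT)); exact: ltry.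
exists M; split; rewrite ?num_real// => r Mr w _.
by apply: le_trans (fM w) _; exact: ltW.
Qed.

(** Bounded convergence: the dominating function is a constant, integrable for a
    probability. *)
Lemma bounded_Rintegral_eq0 (f_ : (T -> R)^nat) f M :
  (forall n, measurable_fun setT (f_ n)) -> measurable_fun setT f ->
  (forall n w, `|f_ n w| <= M) -> (forall w, f_ n w @[n --> \oo] --> f w) ->
  (forall n, \int[P]_w f_ n w = 0) -> \int[P]_w f w = 0.
Proof.
move=> mf_ mf fM ff f0.
have M0 : 0 <= M by apply: le_trans (fM 0%N point).
have [] := @dominated_convergence _ T R P setT measurableT
  (fun n => EFin \o f_ n) (EFin \o f) (EFin \o cst M).
- by move=> n; exact/measurable_EFinP.
- exact/measurable_EFinP.
- by apply: aeW => w _; apply/fine_cvgP; split; [exact: nearW|exact: ff].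
- by apply: (@bounded_integrable _ `|M|).
- by apply: aeW => w n _ /=; rewrite lee_fin.
move=> _ _ /cvg_lim fE; rewrite /Rintegral -[X in fine X]fE//.
rewrite [X in lim (X @ _)](_ : _ = cst 0%E) ?lim_cst//.
apply/funext => n /=; transitivity (\int[P]_w f_ n w)%:E; last by rewrite f0.
rewrite /Rintegral fineK//.
by apply: integrable_fin_num => //; exact: bounded_integrable (mf_ n) (fM n).
Qed.

End bounded_functions.

Section rays.
Variable R : realType.

Lemma bigcup_rays : \bigcup_n `](- n%:R : R)%R, +oo[%classic = setT.
Proof.
apply/seteqP; split => // x _.
exists (Num.bound `|- x|) => //=; rewrite in_itv/= andbT ltrNl.
apply: le_lt_trans (archi_boundP (normr_ge0 _)).
exact: ler_norm.
Qed.

Lemma rays_setI_closed : setI_closed (@RGenOInfty.G R).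
Proof.
move=> _ _ [x ->] [y ->]; exists (Num.max x y).
apply/seteqP; split => t /=; rewrite !in_itv/= !andbT gt_max.
  by case=> -> ->.
by case/andP.
Qed.

End rays.

Section vanishing_moments.
Context d (T : measurableType d) (R : realType) (P : probability T R).
Variables (X g : T -> R) (M : R).
Hypotheses (mX : measurable_fun setT X) (mg : measurable_fun setT g)
  (gM : forall w, `|g w| <= M).

Let M_ge0 : 0 <= M. Proof. exact: le_trans (normr_ge0 _) (gM point). Qed.

Let bounded_mul (a K : R) w : `|a| <= K -> `|a * g w| <= K * M.
Proof. by move=> aK; rewrite normrM ler_pM. Qed.

Let indic_le1 (B : set R) x : `|\1_B x| <= 1 :> R.
Proof. by rewrite indicE ger0_norm ?ler0n//; case: (x \in B). Qed.

Let measurable_mul (phi : R -> R) : measurable_fun setT phi ->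
  measurable_fun setT (fun w => phi (X w) * g w).
Proof.
by move=> mphi; apply: measurable_funM => //; exact: measurableT_comp.
Qed.

Let indic_integrable B : measurable B ->
  P.-integrable setT (fun w => (\1_B (X w) * g w)%:E).
Proof.
move=> mB; apply: (@bounded_integrable _ _ _ P _ (1 * M)) => [|w].
  exact/measurable_mul/measurable_indic.
exact: bounded_mul.
Qed.

(** The sets B with E[1_B(X) g] = 0 form a lambda-system; the signed weight g
    rules out a direct appeal to uniqueness of measures. *)
Lemma Rintegral_rays_Borel_eq0 :
  (forall c, \int[P]_w (\1_(`]c, +oo[) (X w) * g w) = 0) ->
  forall B, measurable B -> \int[P]_w (\1_B (X w) * g w) = 0.
Proof.
move=> h.
pose H := [set B : set R | measurable B /\ \int[P]_w (\1_B (X w) * g w) = 0].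
have Hnd : ndseq_closed H.
  move=> F ndF HF.
  have mU : measurable (\bigcup_i F i).
    by apply: bigcupT_measurable => i; case: (HF i).
  split => //.
  apply: (@bounded_Rintegral_eq0 _ _ _ P
    (fun n w => \1_(F n) (X w) * g w) _ (1 * M)).
  - by move=> n; apply/measurable_mul/measurable_indic; case: (HF n).
  - exact/measurable_mul/measurable_indic.
  - by move=> n w; exact: bounded_mul.
  - move=> w; apply: cvgMl; apply: cvg_near_cst.
    have [[n _ Fn]|nF] := pselect ((\bigcup_i F i) (X w)).
      exists n => //= m nm; rewrite !indicE !mem_set//; first by exists n.
      by move/subsetPset : (ndF _ _ nm); exact.
    apply: nearW => n; rewrite !indicE !memNset// => Fn.
    by apply: nF; exists n.
  - by move=> n; case: (HF n).
have Hray (c : R) : H `]c, +oo[%classic by split => //; exact: measurable_itv.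
have HT : H setT.
  rewrite -bigcup_rays.
  apply: Hnd => // m n mn; apply/subsetPset => x /=.
  by rewrite !in_itv/= !andbT; apply: le_lt_trans; rewrite lerN2 ler_nat.
have HD : setSD_closed H.
  move=> A B BA [mA A0] [mB B0]; split; first exact: measurableD.
  transitivity (\int[P]_w (\1_A (X w) * g w - \1_B (X w) * g w)).
    apply: eq_Rintegral => w _; rewrite -mulrBl; congr (_ * _).
    rewrite !indicE in_setD; have [BX|BX] := pselect (B (X w)).
      by rewrite !mem_set//=; [rewrite subrr|exact: BA].
    by rewrite (memNset BX) andbT subr0.
  by rewrite RintegralB ?A0 ?B0 ?subr0//; exact: indic_integrable.
suff : (measurable : set (set R)) `<=` H by move=> sub B /sub[].
rewrite [X in X `<=` _](RGenOInfty.measurableE R).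
apply: lambda_system_subset => //; first exact: rays_setI_closed.
by move=> _ [x ->].
Qed.

Import HBNNSimple.

(** The standard machine: phi is an increasing limit of simple functions, and
    boundedness of phi lets bounded convergence replace a sign condition on
    g. *)
Lemma Rintegral_Borel_bounded_eq0 :
  (forall B, measurable B -> \int[P]_w (\1_B (X w) * g w) = 0) ->
  forall (phi : R -> R) K, measurable_fun setT phi ->
    (forall x, 0 <= phi x <= K) -> \int[P]_w (phi (X w) * g w) = 0.
Proof.
move=> h phi K mphi phiK.
have mphiE : measurable_fun setT (EFin \o phi) by exact/measurable_EFinP.
pose s := nnsfun_approx measurableT mphiE.
have phi0 x : setT x -> (0 <= (EFin \o phi) x)%E.
  by move=> _; rewrite lee_fin; case/andP: (phiK x).
have sphi n x : 0 <= s n x <= phi x.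
  by rewrite fun_ge0/= -lee_fin /s nnsfun_approxE le_approx.
apply: (@bounded_Rintegral_eq0 _ _ _ P (fun n w => s n (X w) * g w) _ (K * M)).
- by move=> n; exact: measurable_mul.
- exact: measurable_mul.
- move=> n w; apply: bounded_mul; have /andP[s0 sle] := sphi n (X w).
  by rewrite ger0_norm//; apply: le_trans sle _; case/andP: (phiK (X w)).
- move=> w; apply: cvgMl.
  have := @cvg_nnsfun_approx _ _ _ _ measurableT _ mphiE phi0 (X w) I.
  by case/fine_cvgP.
move=> n.
transitivity (\int[P]_w (\sum_(y <- fset_set (range (s n)))
    y * (\1_(s n @^-1` [set y]) (X w) * g w))).
  apply: eq_Rintegral => w _; rewrite fimfunE fsbig_finite//= mulr_suml.
  by apply: eq_bigr => y _; rewrite mulrA.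
have mlev y : measurable (s n @^-1` [set y]) by [].
have iterm y : P.-integrable setT
    (EFin \o (fun w => y * (\1_(s n @^-1` [set y]) (X w) * g w))).
  exact: (integrableZl measurableT y (indic_integrable (mlev y))).
elim: (fset_set (range (s n)) : seq R) => [|y r ih].
  under eq_Rintegral do rewrite big_nil.
  by rewrite Rintegral_cst// mul0r.
under eq_Rintegral do rewrite big_cons.
rewrite RintegralD//=.
- by rewrite RintegralZl//= ?h ?mulr0 ?add0r//; exact: indic_integrable.
rewrite (_ : EFin \o _ = (fun w => \sum_(z <- r)
    (z * (\1_(s n @^-1` [set z]) (X w) * g w))%:E)%E).
  by apply: integrable_sum => // z _; exact: iterm.
by apply/funext => w /=; rewrite sumEFin.
Qed.

End vanishing_moments.

(** * The uniform distribution on the unit interval *)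

Lemma probability_setI_full d (T : measurableType d) (R : realType)
    (P : probability T R) (A C : set T) :
  measurable A -> measurable C -> P C = 1%E -> P (A `&` C) = P A.
Proof.
move=> mA mC C1.
have CC0 : P (~` C) = 0%E by rewrite probability_setC// C1 subee.
have C0 : P (A `\` C) = 0%E.
  apply: (subset_measure0 (measurableD mA mC) (measurableC mC)) => [w []//|].
  exact: CC0.
have PA : (P A = P (A `\` C) + P (A `&` C))%E by exact: measureDI.
by rewrite PA C0 add0e.
Qed.

Section uniform_distribution.
Variable R : realType.
Local Notation U01 := (uniform_prob (@ltr01 R)).

Lemma uniform01_ray (u : R) : 0 <= u <= 1 -> U01 `]-oo, u] = u%:E.
Proof.
move=> /andP[u0 u1]; rewrite /uniform_prob integral_uniform_pdf.
rewrite (_ : _ `&` _ = `[0, u]%classic); last first.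
  apply/seteqP; split => x /=; rewrite !in_itv/=; first by case=> ->/andP[->].
  by move=> /andP[-> xu]; rewrite xu (le_trans xu).
rewrite (eq_integral (cst 1%E)); last first.
  move=> x; rewrite inE/= in_itv/= => /andP[x0 xu].
  by rewrite /uniform_pdf x0 (le_trans xu)// subr0 invr1.
by rewrite integral_cst//= lebesgue_measure_itv/= lte_fin mul1e;
  case: ltgtP u0 => // [_ _|<- _]; rewrite -?EFinD ?subr0.
Qed.

Lemma uniform01_support : U01 `]0, 1] = 1%E.
Proof.
rewrite (_ : `]0, 1]%classic = `]-oo, 1] `\` `]-oo, 0%R]).
  rewrite measureD//=.
  - rewrite (setIidr _) ?uniform01_ray ?lexx ?ler01// ?sube0//.
    by apply: subset_itvl; rewrite bnd_simp.
  - by rewrite uniform01_ray ?lexx ?ler01// ltry.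
apply/seteqP; split => x /=; rewrite !in_itv/= ltNge.
  by move=> /andP[/negP].
by move=> [-> /negP->].
Qed.

Lemma eq_probability_rays (mu nu : probability R R) :
  (forall c : R, mu `]-oo, c]%classic = nu `]-oo, c]%classic) ->
  forall B, measurable B -> mu B = nu B.
Proof.
move=> munu B mB; apply: (@measure_unique _ R _ (@RGenOInfty.G R)
  (fun n => `](- n%:R)%R, +oo[%classic) _ _ _ _ mu nu _ _ B mB).
- exact: RGenOInfty.measurableE.
- exact: rays_setI_closed.
- by move=> n; exists (- n%:R).
- exact: bigcup_rays.
- move=> _ [c ->].
  have rayC (m : probability R R) :
      m `]c, +oo[%classic = (1 - m `]-oo, c]%classic)%E.
    by rewrite -setCitvl probability_setC.
  by have := rayC mu; rewrite munu -rayC.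
- by move=> n; apply: (le_lt_trans (probability_le1 _ _)) => //; exact: ltry.
Qed.

End uniform_distribution.

Section uniform01_rays.
Context d (T : measurableType d) (R : realType) (P : probability T R).
Variables (X V : T -> R).
Hypotheses (mX : measurable_fun setT X) (uV : uniform01 P V).

#[local] HB.instance Definition _ := @isMeasurableFun.Build _ _ _ _ X mX.
#[local] HB.instance Definition _ :=
  @isMeasurableFun.Build _ _ _ _ V (proj1 uV).

(** Both laws are compared as image measures on the line: the uniform measure
    itself lives on another presentation of the Borel sigma-algebra. *)
Lemma uniform01_rays :
  (forall c : R, P (X @^-1` `]-oo, c]) = P (V @^-1` `]-oo, c])) ->
  uniform01 P X.
Proof.
move=> XV; split=> // B mB; rewrite -(proj2 uV B mB).
exact: (@eq_probability_rays _ (distribution P X) (distribution P V)).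
Qed.

End uniform01_rays.

Section independent_uniform.
Context d (T : measurableType d) (R : realType) (P : probability T R).
Variables (U V : T -> R).
Hypotheses (mU : measurable_fun setT U) (U01 : forall w, 0 <= U w <= 1)
  (uV : uniform01 P V)
  (UV : forall A B, measurable A -> measurable B ->
     P (V @^-1` A `&` U @^-1` B) = (P (V @^-1` A) * P (U @^-1` B))%E).

Let UV_ (w : T) : R * R := (U w, V w).

Let mUV : measurable_fun setT UV_.
Proof. by case: uV => mV _; exact: measurable_fun_pair. Qed.

#[local] HB.instance Definition _ := @isMeasurableFun.Build _ _ _ _ U mU.
#[local] HB.instance Definition _ :=
  @isMeasurableFun.Build _ _ _ _ V (proj1 uV).
#[local] HB.instance Definition _ :=
  @isMeasurableFun.Build _ _ _ _ UV_ mUV.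

(** By independence the joint law of U and V is a product measure; integrating
    the section {v | v <= u}, of uniform mass u, against the law of U gives
    E[U]. *)
Lemma independent_uniform_le :
  P [set w | V w <= U w] = (\int[P]_w (U w)%:E)%E.
Proof.
have [_ lawV] := uV.
pose A := [set x : R * R | x.2 <= x.1].
have mA : measurable A.
  rewrite (_ : A = (fun x : R * R => x.2 <= x.1) @^-1` [set true]).
    rewrite -[X in measurable X]setTI; apply: measurable_fun_ler => //.
  by apply/seteqP; split.
transitivity ((distribution P U \x distribution P V)%E A).
  transitivity (distribution P UV_ A) => //.
  apply/esym/product_measure_unique => // B C mB mC.
  rewrite [RHS]muleC /distribution /pushforward -UV//.
  by congr (P _); apply/seteqP; split => w /= [].
rewrite /product_measure1 ge0_integral_distribution//=.
  apply: eq_integral => w _ /=; rewrite -uniform01_ray// -lawV//.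
  congr (P _); apply/seteqP.
  by split => v; rewrite /xsection/= inE/= in_itv.
exact: measurable_fun_xsection.
Qed.

End independent_uniform.

(** * The kernel of the probability integral transform *)

(** Up to sign and the factor x (1 - x), the Green function of the second
    derivative on [0, 1], since x (1 - x) k_z(x) = min(x, z) - x z. The two
    branches spell out the quotient so that x = 0 and x = 1 need no separate
    convention when 0 <= z < 1. *)
Definition pit_kernel (R : realType) (z x : R) : R :=
  if x <= z then (1 - z) / (1 - x) else z / x.

(** The derivative of pit_kernel z x in z at z = c, from the right. *)
Definition pit_kernel_slope (R : realType) (c x : R) : R :=
  if x <= c then - (1 - x)^-1 else x^-1.

Section pit_kernel.
Variable R : realType.
Implicit Types c z x v y q : R.

(** The right-hand side is the probability, given p = q and Y = y, that the
    transform is at most z. *)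
Lemma pit_kernelP z q y : 0 <= z < 1 -> 0 <= q <= 1 -> y = 0 \/ y = 1 ->
  z + pit_kernel z q * (1 - y - q) =
  if q <= z then (if y == 0 then 1 else (z - q) / (1 - q))
  else (if y == 0 then z / q else 0).
Proof.
move=> /andP[z0 z1] /andP[q0 q1] y01; rewrite /pit_kernel.
have [qz|qz] := leP q z; case: y01 => ->; rewrite ?eqxx ?oner_eq0.
- by field; rewrite subr_eq0 gt_eqF// (le_lt_trans qz).
- by field; rewrite subr_eq0 gt_eqF// (le_lt_trans qz).
- by field; rewrite gt_eqF// (le_lt_trans z0).
- by field; rewrite gt_eqF// (le_lt_trans z0).
Qed.

Lemma pit_threshold_itv z q y : 0 <= z < 1 -> 0 <= q <= 1 -> y = 0 \/ y = 1 ->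
  0 <= z + pit_kernel z q * (1 - y - q) <= 1.
Proof.
move=> z01 q01 y01; rewrite pit_kernelP//.
move/andP: z01 => [z0 z1]; move/andP: q01 => [q0 q1].
have [qz|qz] := leP q z; case: y01 => ->;
  rewrite ?eqxx ?oner_eq0 ?lexx ?ler01//.
- have ? : 0 < 1 - q by lra.
  by rewrite divr_ge0 ?ler_pdivrMr//=; lra.
- have ? : 0 < q by lra.
  by rewrite divr_ge0 ?ler_pdivrMr//=; lra.
Qed.

(** The polynomial in q, y and v is the value of the transform. At v = 0 the two
    sides differ: for y = 1 and z < q the transform exceeds z although the
    threshold is 0. *)
Lemma pit_le_threshold z q y v : 0 <= z < 1 -> 0 <= q <= 1 ->
  y = 0 \/ y = 1 -> 0 < v <= 1 ->
  (q * y + v * (q + y - 2 * q * y) <= z) =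
  (v <= z + pit_kernel z q * (1 - y - q)).
Proof.
move=> z01 q01 y01 v01; rewrite pit_kernelP//.
move/andP: z01 => [z0 z1]; move/andP: q01 => [q0 q1].
move/andP: v01 => [v0 v1].
have [qz|qz] := leP q z; case: y01 => ->; rewrite ?eqxx ?oner_eq0.
- by apply/idP/idP => _ //; nra.
- have ? : 0 < 1 - q by lra.
  by rewrite ler_pdivlMr//; apply/idP/idP; lra.
- have ? : 0 < q by lra.
  by rewrite ler_pdivlMr//; apply/idP/idP; lra.
- by apply/idP/idP; nra.
Qed.

Lemma pit_kernel_itv z x : 0 <= z < 1 -> 0 <= pit_kernel z x <= 1.
Proof.
move=> /andP[z0 z1]; rewrite /pit_kernel; have [xz|xz] := leP x z.
  have ? : 0 < 1 - x by lra.
  by rewrite divr_ge0 ?ler_pdivrMr//=; lra.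
have ? : 0 < x by lra.
by rewrite divr_ge0 ?ler_pdivrMr//=; lra.
Qed.

Lemma measurable_pit_kernel z : measurable_fun setT (pit_kernel z).
Proof.
apply: measurable_fun_ifT; first exact: measurable_fun_ler.
- apply: measurable_funM => //; apply: measurableT_comp.
    exact: measurable_funV.
  exact: measurable_funB.
- by apply: measurable_funM => //; exact: measurable_funV.
Qed.

Lemma measurable_pit_kernel_slope c :
  measurable_fun setT (pit_kernel_slope c).
Proof.
apply: measurable_fun_ifT; first exact: measurable_fun_ler.
- apply: measurableT_comp => //; apply: measurableT_comp.
    exact: measurable_funV.
  exact: measurable_funB.
- exact: measurable_funV.
Qed.

Lemma pit_kernel_slope_le c x : 0 < c < 1 ->
  `|pit_kernel_slope c x| <= c^-1 + (1 - c)^-1.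
Proof.
move=> /andP[c0 c1]; rewrite /pit_kernel_slope.
have ? : 0 < c^-1 by rewrite invr_gt0.
have ? : 0 < (1 - c)^-1 by rewrite invr_gt0; lra.
have [xc|xc] := leP x c.
  have ? : 0 < 1 - x by lra.
  rewrite normrN ger0_norm ?invr_ge0 ?(ltW)//.
  have : (1 - x)^-1 <= (1 - c)^-1 by rewrite lef_pV2 ?posrE//; lra.
  lra.
have ? : 0 < x by lra.
rewrite ger0_norm ?invr_ge0 ?(ltW)//.
have : x^-1 <= c^-1 by rewrite lef_pV2 ?posrE//; lra.
lra.
Qed.

(** For x outside ]c, z] the kernel is affine in its index on [c, z], so the
    difference quotient equals the derivative exactly; convergence of the
    quotients is then eventual equality. *)
Lemma pit_kernel_quotient c z x : 0 < c -> c < z -> z < 1 ->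
  ~~ (c < x <= z) ->
  (z - c)^-1 * (pit_kernel z x - pit_kernel c x) = pit_kernel_slope c x.
Proof.
move=> c0 cz z1; rewrite negb_and -leNgt -ltNge /pit_kernel /pit_kernel_slope.
have [xc _|cx /= zx] := leP x c.
  rewrite (le_trans xc (ltW cz)); field.
  by apply/andP; split; [lra|lra].
rewrite (leNgt x z) zx /=; field; apply/andP; split; lra.
Qed.

(** On ]c, z] the quotient lies between the two branches of the slope, because
    x >= c and x <= z bound the jump of the kernel from either side; the bound
    does not degenerate as z tends to c. *)
Lemma pit_kernel_quotient_le c z x : 0 < c -> c < z -> z < 1 ->
  `|(z - c)^-1 * (pit_kernel z x - pit_kernel c x)| <= c^-1 + (1 - z)^-1.
Proof.
move=> c0 cz z1.
have ? : 0 < c^-1 by rewrite invr_gt0.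
have ? : 0 < (1 - z)^-1 by rewrite invr_gt0; lra.
have [/andP[cx xz]|nxcz] := boolP (c < x <= z); last first.
  rewrite pit_kernel_quotient//; apply: le_trans (pit_kernel_slope_le _ _) _.
    by rewrite c0; lra.
  by rewrite lerD2l lef_pV2 ?posrE//; lra.
rewrite /pit_kernel xz (leNgt x c) cx /=.
have ? : 0 < x by lra.
have ? : 0 < 1 - x by lra.
have xVc : x^-1 <= c^-1 by rewrite lef_pV2 ?posrE//; lra.
have xVz : (1 - x)^-1 <= (1 - z)^-1 by rewrite lef_pV2 ?posrE//; lra.
have zc : 0 < z - c by lra.
have up : (1 - z) / (1 - x) <= z / x.
  by rewrite ler_pdivrMr// mulrAC ler_pdivlMr//; lra.
have lo : c / x <= (1 - c) / (1 - x).
  by rewrite ler_pdivrMr// mulrAC ler_pdivlMr//; lra.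
rewrite ler_norml mulrC ler_pdivlMr// ler_pdivrMr//; apply/andP; split.
  nra.
nra.
Qed.

End pit_kernel.

(** * Moments against the kernel determine moments against Borel sets *)

Section calibration_kernels.
Context d (T : measurableType d) (R : realType) (P : probability T R).
Variables (X D : T -> R).
Hypotheses (mX : measurable_fun setT X) (mD : measurable_fun setT D)
  (X01 : forall w, 0 <= X w <= 1) (D1 : forall w, `|D w| <= 1).

Let null_mean (f : T -> R) :=
  P.-integrable setT (EFin \o f) /\ \int[P]_w f w = 0.

Let null_meanD a b f g : null_mean f -> null_mean g ->
  null_mean (fun w => a * f w + b * g w).
Proof.
move=> [intf f0] [intg g0].
have iaf : P.-integrable setT (EFin \o (fun w => a * f w)).
  exact: (integrableZl measurableT a intf).
have ibg : P.-integrable setT (EFin \o (fun w => b * g w)).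
  exact: (integrableZl measurableT b intg).
split; first exact: (integrableD measurableT iaf ibg).
by rewrite RintegralD// !RintegralZl// f0 g0 !mulr0 addr0.
Qed.

Let mul_bounded_integrable (phi : R -> R) K : measurable_fun setT phi ->
  (forall w, `|phi (X w)| <= K) ->
  P.-integrable setT (EFin \o (fun w => phi (X w) * D w)).
Proof.
move=> mphi phiK; apply: (@bounded_integrable _ _ _ P _ (K * 1)).
  by apply: measurable_funM => //; exact: measurableT_comp.
by move=> w; rewrite normrM ler_pM.
Qed.

Section kernel_moments.
Hypothesis kernel0 : forall z, 0 <= z < 1 ->
  \int[P]_w (pit_kernel z (X w) * D w) = 0.

Let null_kernel z : 0 <= z < 1 ->
  null_mean (fun w => pit_kernel z (X w) * D w).
Proof.
move=> z01; split; last exact: kernel0.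
apply: (mul_bounded_integrable (K := 1)) => [|w].
  exact: measurable_pit_kernel.
by case/andP: (pit_kernel_itv (X w) z01) => k0 k1; rewrite ger0_norm.
Qed.

(** The difference quotients of the kernel along z_n decreasing to c have
    integral zero, and they converge boundedly. *)
Lemma pit_kernel_moments_slope c : 0 < c < 1 ->
  \int[P]_w (pit_kernel_slope c (X w) * D w) = 0.
Proof.
move=> /andP[c0 c1].
(* The factor (1 - c) / 2 keeps 1 - z_n away from 0 for the uniform bound. *)
pose z n := c + (1 - c) / 2 * @harmonic R n.
have zc n : c < z n.
  by rewrite /z ltrDl mulr_gt0 ?harmonic_gt0// divr_gt0//; lra.
have zle n : z n <= c + (1 - c) / 2.
  rewrite /z lerD2l ler_piMr//; first by rewrite divr_ge0//; lra.
  by rewrite /harmonic/= invf_le1// ler1n.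
have z1 n : z n < 1 by apply: le_lt_trans (zle n) _; lra.
have zcvg : z n @[n --> \oo] --> c.
  rewrite -[X in _ --> X]addr0; apply: cvgD; first exact: cvg_cst.
  by rewrite -(mulr0 ((1 - c) / 2)); apply: cvgMr; exact: cvg_harmonic.
pose q n w := (z n - c)^-1 * (pit_kernel (z n) (X w) - pit_kernel c (X w)).
have mq n : measurable_fun setT (q n).
  by apply: measurable_funM => //; apply: measurable_funB;
    apply: measurableT_comp => //; exact: measurable_pit_kernel.
apply: (@bounded_Rintegral_eq0 _ _ _ P (fun n w => q n w * D w) _
  ((c^-1 + ((1 - c) / 2)^-1) * 1)).
- by move=> n; exact: measurable_funM.
- apply: measurable_funM => //; apply: measurableT_comp => //.
  exact: measurable_pit_kernel_slope.
- move=> n w; rewrite normrM ler_pM//.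
  apply: le_trans (pit_kernel_quotient_le (X w) c0 (zc n) (z1 n)) _.
  by rewrite lerD2l lef_pV2 ?posrE//; have := zle n; have := z1 n; lra.
- move=> w; apply: cvgMl; apply: cvg_near_cst.
  have [Xc|cX] := leP (X w) c.
    by apply: nearW => n; rewrite /q pit_kernel_quotient// ltNge Xc.
  have : \forall n \near \oo, z n < X w by exact: (cvgr_lt _ zcvg).
  apply: filterS => n zX.
  by rewrite /q pit_kernel_quotient// negb_and -ltNge zX orbT.
- move=> n.
  rewrite (_ : (fun w => q n w * D w) = (fun w =>
    (z n - c)^-1 * (pit_kernel (z n) (X w) * D w) +
    (- (z n - c)^-1) * (pit_kernel c (X w) * D w))); last first.
    by apply/funext => w; rewrite /q; ring.
  apply: (null_meanD _ _ (null_kernel _) (null_kernel _)).2.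
    by rewrite z1 andbT ltW// (lt_trans c0).
  by rewrite ltW.
Qed.

(** Testing with k_{1/2} times indicators, rather than with indicators, is what
    makes rays reachable: multiplied by x (1 - x), the function
    1_{x > c} k_{1/2}(x) is piecewise affine and vanishes at 0 and 1 like the
    kernels, and the slope at c supplies its jump. *)
Lemma pit_kernel_moments_Borel B : measurable B ->
  \int[P]_w (\1_B (X w) * D w) = 0.
Proof.
have null_slope c : 0 < c < 1 ->
    null_mean (fun w => pit_kernel_slope c (X w) * D w).
  move=> c01; split; last exact: pit_kernel_moments_slope.
  apply: (mul_bounded_integrable (K := c^-1 + (1 - c)^-1)) => [|w].
    exact: measurable_pit_kernel_slope.
  exact: pit_kernel_slope_le.
pose k := @pit_kernel R 2^-1.
have half01 : 0 <= (2^-1 : R) < 1 by lra.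
have kD0 : null_mean (fun w => k (X w) * D w) by exact: null_kernel.
have mk : measurable_fun setT k by exact: measurable_pit_kernel.
have k01 x : 0 <= k x <= 1 by exact: pit_kernel_itv.
have k_ge w : 2^-1 <= k (X w).
  have /andP[X0 X1] := X01 w; rewrite /k /pit_kernel.
  have [Xh|hX] := leP (X w) 2^-1.
    have ? : 0 < 1 - X w by lra.
    by rewrite ler_pdivlMr//; lra.
  have ? : 0 < X w by lra.
  by rewrite ler_pdivlMr//; lra.
have rays c : \int[P]_w (\1_(`]c, +oo[) (X w) * (k (X w) * D w)) = 0.
  have rayE w : \1_(`]c, +oo[) (X w) = (c < X w)%R%:R :> R.
    rewrite indicE; congr (nat_of_bool _)%:R.
    by apply/idP/idP; rewrite ?inE/= in_itv/= andbT.
  have [c0|c0] := ltP c 0.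
    rewrite -[RHS](kD0.2); apply: eq_Rintegral => w _.
    by rewrite rayE (lt_le_trans c0) ?mul1r//; case/andP: (X01 w).
  have [c1|c1] := leP 1 c.
    rewrite -[RHS](mul0r (fine (P setT))) -Rintegral_cst//.
    apply: eq_Rintegral => w _; rewrite rayE ltNge (le_trans _ c1) ?mul0r//.
    by case/andP: (X01 w).
  have [ch|hc] := ltP c 2^-1; last first.
    (* Right of c, k_c + (1 - c) h_c is 1 / x; left of c, it vanishes. *)
    have c01 : 0 < c < 1 by lra.
    have /null_slope nullh := c01.
    have /null_kernel nullk : 0 <= c < 1 by lra.
    rewrite -[RHS](null_meanD 2^-1 (2^-1 * (1 - c)) nullk nullh).2.
    apply: eq_Rintegral => w _; have /andP[X0 X1] := X01 w.
    rewrite rayE /k /pit_kernel /pit_kernel_slope ltNge.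
    have [Xc|cX] := leP (X w) c => /=; first by field; lra.
    by rewrite leNgt (le_lt_trans hc cX)/=; field; lra.
  (* Left of c, k_c - c h_c is 1 / (1 - x); right of c, it vanishes. At c = 0
     the slope is unbounded, but its coefficient c is 0. *)
  have nullc : null_mean (fun w => c * (pit_kernel_slope c (X w) * D w)).
    have [c_gt0|c_le0] := ltP 0 c.
      have := null_meanD 0 c kD0 (null_slope c _).
      rewrite (_ : (fun w => _ + _) =
        fun w => c * (pit_kernel_slope c (X w) * D w)).
        by apply; rewrite c_gt0.
      by apply/funext => w; rewrite mul0r add0r.
    have := null_meanD 0 0 kD0 kD0.
    rewrite (_ : (fun w => _ + _) =
      fun w => c * (pit_kernel_slope c (X w) * D w))//.
    apply/funext => w; have -> : c = 0 by lra.
    by rewrite !mul0r addr0.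
  have /null_kernel nullk : 0 <= c < 1 by lra.
  have := null_meanD 1 1 kD0 (null_meanD (- 2^-1) 2^-1 nullk nullc).
  move=> [_ E0]; rewrite -[RHS]E0.
  apply: eq_Rintegral => w _; have /andP[X0 X1] := X01 w.
  rewrite rayE /k /pit_kernel /pit_kernel_slope ltNge.
  have [Xc|cX] := leP (X w) c => /=; last by field; lra.
  by rewrite (le_trans Xc (ltW ch)); field; lra.
have mkD : measurable_fun setT (fun w => k (X w) * D w).
  by apply: measurable_funM => //; exact: measurableT_comp.
have kDle1 w : `|k (X w) * D w| <= 1.
  rewrite normrM -[leRHS]mulr1 ler_pM// ger0_norm; by case/andP: (k01 (X w)).
have Borel0 := Rintegral_rays_Borel_eq0 mX mkD kDle1 rays.
move=> mB.
(* The maximum makes the quotient by k bounded off [0, 1] as well. *)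
pose phi x := \1_B x * (Num.max (k x) 2^-1)^-1 : R.
rewrite -[RHS](@Rintegral_Borel_bounded_eq0 _ _ _ P X (fun w => k (X w) * D w)
  1 mX mkD kDle1 Borel0 phi 2).
- apply: eq_Rintegral => w _; rewrite /phi.
  rewrite (max_idPl (k_ge w)); field.
  by rewrite gt_eqF//; apply: lt_le_trans (k_ge w).
- apply: measurable_funM; first exact: measurable_indic.
  apply: measurableT_comp; first exact: measurable_funV.
  exact: measurable_maxr.
- move=> x; rewrite /phi.
  have m_ge : 2^-1 <= Num.max (k x) 2^-1 by rewrite le_max lexx orbT.
  have m_gt0 : 0 < Num.max (k x) 2^-1 by apply: lt_le_trans m_ge.
  have mV : (Num.max (k x) 2^-1)^-1 <= 2.
    by rewrite -[leRHS]invrK lef_pV2// posrE.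
  have mV0 : 0 <= (Num.max (k x) 2^-1)^-1 by rewrite invr_ge0 ltW.
  rewrite indicE; case: (x \in B); rewrite ?mul1r ?mul0r; lra.
Qed.

End kernel_moments.

Lemma Borel_moments_pit_kernel :
  (forall B, measurable B -> \int[P]_w (\1_B (X w) * D w) = 0) ->
  forall z, 0 <= z < 1 -> \int[P]_w (pit_kernel z (X w) * D w) = 0.
Proof.
move=> h z z01; apply: (Rintegral_Borel_bounded_eq0 mX mD D1 h (K := 1)).
  exact: measurable_pit_kernel.
by move=> x; exact: pit_kernel_itv.
Qed.

End calibration_kernels.

(** * Calibration of binary forecasts *)

Lemma binary_cdf_lt0 (R : realType) (q y : R) : y < 0 -> binary_cdf q y = 0.
Proof.
move=> y0; rewrite /binary_cdf !indicE !memNset ?mulr0 ?addr0//=; lra.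
Qed.

Lemma binary_cdf_lt1 (R : realType) (q y : R) :
  0 <= y -> y < 1 -> binary_cdf q y = q.
Proof.
move=> y0 y1; rewrite /binary_cdf !indicE mem_set//= memNset/=; last lra.
by rewrite mulr0 mulr1 addr0.
Qed.

Lemma binary_cdf_ge1 (R : realType) (q y : R) : 1 <= y -> binary_cdf q y = 1.
Proof. by move=> y1; rewrite /binary_cdf !indicE !mem_set//=; lra. Qed.

(** The left limit of the CDF at the outcome is 0 for Y = 0 and p for Y = 1; the
    polynomial interpolates V p and p + V (1 - p). *)
Lemma binary_pitE (R : realType) d (T : measurableType d) (p Y V : T -> R) w :
  Y w = 0 \/ Y w = 1 ->
  pit (fun w => binary_cdf (p w)) Y V w =
  p w * Y w + V w * (p w + Y w - 2 * p w * Y w).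
Proof.
have l0 : lim (binary_cdf (p w) y @[y --> (0 : R)^'-]) = 0.
  apply: lim_near_cst => //; near=> y; apply: binary_cdf_lt0.
  by near: y; exact: nbhs_left_lt.
have l1 : lim (binary_cdf (p w) y @[y --> (1 : R)^'-]) = p w.
  apply: lim_near_cst => //; near=> y; apply: binary_cdf_lt1.
    by near: y; apply: nbhs_left_ge; exact: ltr01.
  by near: y; exact: nbhs_left_lt.
rewrite /pit => -[] ->.
  by rewrite l0 binary_cdf_lt1//; ring.
by rewrite l1 binary_cdf_ge1//; ring.
Unshelve. all: by end_near. Qed.

Section binary_prediction_space.
Context (R : realType) (d : measure_display) (T : measurableType d)
  (P : probability T R) (A1 : set (set T)) (p : T -> R) (Y V : {RV P >-> R}).
Hypotheses (p01 : forall w, 0 <= p w <= 1)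
  (Y01 : forall w, Y w = 0 \/ Y w = 1)
  (hps : prediction_space A1 (fun w => binary_cdf (p w)) Y V).

Let D w : R := 1 - Y w - p w.
Let Z := pit (fun w => binary_cdf (p w)) Y V.

Let ZE w : Z w = p w * Y w + V w * (p w + Y w - 2 * p w * Y w).
Proof. exact: binary_pitE. Qed.

(** The forecast is the value of its CDF at 0. *)
Lemma forecast_measurable_wrt : measurable_wrt A1 p.
Proof.
have [_ _ mF _ _] := hps.
have -> : p = fun w => binary_cdf (p w) 0.
  by apply/funext => w; rewrite binary_cdf_lt1.
exact: mF.
Qed.

Lemma forecast_measurable : measurable_fun setT p.
Proof.
have [[_ A1m] _ _ _ _] := hps.
move=> _ B mB; apply: A1m; apply: forecast_measurable_wrt.
by exists B.
Qed.

Let mp := forecast_measurable.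

Let mD : measurable_fun setT D.
Proof. by apply: measurable_funB => //; exact: measurable_funB. Qed.

Lemma residual_le1 w : `|1 - Y w - p w| <= 1.
Proof.
by rewrite ler_norml; have := p01 w; case: (Y01 w) => ->; lra.
Qed.

Let D1 w : `|D w| <= 1. Proof. exact: residual_le1. Qed.

Let mZ : measurable_fun setT Z.
Proof.
rewrite (_ : Z = fun w => p w * Y w + V w * (p w + Y w - 2 * p w * Y w)).
  apply: measurable_funD; apply: measurable_funM => //.
  apply: measurable_funB; first exact: measurable_funD.
  by apply: measurable_funM => //; exact: measurable_funM.
by apply/funext => w; exact: ZE.
Qed.

Let V_support : P (V @^-1` `]0, 1]) = 1%E.
Proof.
have [_ _ _ [_ lawV] _] := hps.
by rewrite lawV ?uniform01_support//; exact: measurable_itv.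
Qed.

(** V is independent of the whole sigma-algebra generated by A1 and Y, and the
    threshold is measurable for it because p and Y are. *)
Let threshold_independent z A B : measurable A -> measurable B ->
  let U w := z + pit_kernel z (p w) * D w in
  P (V @^-1` A `&` U @^-1` B) = (P (V @^-1` A) * P (U @^-1` B))%E.
Proof.
move=> mA mB U; have [_ _ _ _ indep] := hps.
apply: indep; first by exists A => //; rewrite setTI.
pose G := A1 `|` g_sigma_algebra_preimage Y.
have mpG : measurable_fun setT (p : g_sigma_algebraType G -> R).
  move=> _ C mC; apply: sub_sigma_algebra; left.
  by apply: forecast_measurable_wrt; exists C.
have mYG : measurable_fun setT (Y : g_sigma_algebraType G -> R).
  by move=> _ C mC; apply: sub_sigma_algebra; right; exists C.
have mUG : measurable_fun setT (U : g_sigma_algebraType G -> R).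
  apply: measurable_funD => //; apply: measurable_funM.
    by apply: measurableT_comp mpG; exact: measurable_pit_kernel.
  by apply: measurable_funB => //; exact: measurable_funB.
by have := mUG measurableT B mB; rewrite setTI.
Qed.

(** Up to the null set where V leaves ]0, 1], the event Z <= z is V <= U with
    U = z + k_z(p) D independent of V, and it has probability E[U]. *)
Lemma pit_cdf z : 0 <= z < 1 ->
  P (Z @^-1` `]-oo, z]) =
  (z + \int[P]_w (pit_kernel z (p w) * D w))%:E.
Proof.
move=> z01; pose U w := z + pit_kernel z (p w) * D w.
have [_ _ _ uV _] := hps.
have mk : measurable_fun setT (fun w => pit_kernel z (p w) * D w).
  apply: measurable_funM => //; apply: measurableT_comp => //.
  exact: measurable_pit_kernel.
have mU : measurable_fun setT U by exact: measurable_funD.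
have U01 w : 0 <= U w <= 1.
  by apply: pit_threshold_itv; [|exact: p01|exact: Y01].
have kD1 w : `|pit_kernel z (p w) * D w| <= 1.
  rewrite normrM -[leRHS]mulr1 ler_pM// ger0_norm;
    by case/andP: (pit_kernel_itv (p w) z01).
have mVU : measurable [set w | V w <= U w].
  rewrite (_ : [set w | _] = (fun w => V w <= U w) @^-1` [set true]).
    by rewrite -[X in measurable X]setTI; apply: measurable_fun_ler.
  by apply/seteqP; split.
have mZz : measurable (Z @^-1` `]-oo, z]).
  by rewrite -[X in measurable X]setTI; apply: mZ.
have mVs : measurable (V @^-1` `]0, 1]).
  exact: (measurable_funPTI V (measurable_itv _)).
rewrite -(probability_setI_full mZz mVs V_support).
transitivity (P ([set w | V w <= U w] `&` V @^-1` `]0, 1])).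
  congr (P _); apply/seteqP; split=> w [Zw Vw]; split => //; move: Zw Vw;
    by rewrite /= !in_itv/= ZE => Zw V01; move: Zw;
      rewrite pit_le_threshold//; exact: Y01.
rewrite (probability_setI_full mVU mVs V_support).
rewrite (independent_uniform_le mU U01 uV (threshold_independent z)).
have ik : P.-integrable setT (EFin \o fun w => pit_kernel z (p w) * D w).
  exact: bounded_integrable mk kD1.
transitivity (\int[P]_w (U w))%:E.
  rewrite /Rintegral fineK//; apply: integrable_fin_num => //.
  apply: (@bounded_integrable _ _ _ P U 1) => // w.
  by case/andP: (U01 w) => U0 U1; rewrite ger0_norm.
rewrite RintegralD//; last exact: finite_measure_integrable_cst.
rewrite Rintegral_cst// [X in _ * X](_ : _ = 1) ?mulr1//.
exact: (congr1 fine (probability_setT P)).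
Qed.

Let Z_itv w : 0 < V w <= 1 -> 0 <= Z w <= 1.
Proof.
by rewrite ZE => V01; have := p01 w; case: (Y01 w) => ->; nra.
Qed.

Lemma probabilistically_calibratedP :
  probabilistically_calibrated P (fun w => binary_cdf (p w)) Y V <->
  forall z, 0 <= z < 1 -> \int[P]_w (pit_kernel z (p w) * D w) = 0.
Proof.
have [_ _ _ uV _] := hps.
split=> [[_ lawZ] z z01|h].
  have := pit_cdf z01; rewrite lawZ; last exact: measurable_itv.
  rewrite uniform01_ray; last by lra.
  by case=> zE; lra.
apply: (uniform01_rays _ uV) => // c.
have mpre (X : T -> R) : measurable_fun setT X ->
    measurable (X @^-1` `]-oo, c]).
  by move=> mX; rewrite -[X in measurable X]setTI; apply: mX.
have mVs : measurable (V @^-1` `]0, 1]).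
  exact: (measurable_funPTI V (measurable_itv _)).
have [c0|c0] := ltP c 0.
  rewrite -(probability_setI_full (mpre _ mZ) mVs V_support).
  rewrite -(probability_setI_full (mpre V _) mVs V_support)//.
  congr (P _); apply/seteqP; split => w /=; rewrite !in_itv/= => -[le_c V01];
    have := Z_itv V01; lra.
have [c1|c1] := leP 1 c.
  rewrite -(probability_setI_full (mpre _ mZ) mVs V_support).
  rewrite -(probability_setI_full (mpre V _) mVs V_support)//.
  congr (P _); apply/seteqP; split => w /=; rewrite !in_itv/= => -[le_c V01];
    split=> //; have := Z_itv V01; lra.
have c01 : 0 <= c < 1 by rewrite c0.
rewrite pit_cdf// h// addr0 (proj2 uV); last exact: measurable_itv.
by rewrite uniform01_ray// c0 ltW.
Qed.

Let int_forecast B : measurable B ->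
  (\int[P]_(w in p @^-1` B) (p w)%:E)%E =
  (\int[P]_w (\1_B (p w) * p w))%:E.
Proof.
move=> mB; rewrite /Rintegral fineK.
  rewrite [LHS]integral_mkcond; apply: eq_integral => w _.
  rewrite patchE /= indicE (_ : (w \in p @^-1` B) = (p w \in B)); last first.
    by apply/idP/idP; rewrite !inE.
  by case: ifPn => _; rewrite ?mul1r ?mul0r.
apply: integrable_fin_num => //.
apply: (@bounded_integrable _ _ _ P _ 1) => [|w].
  apply: measurable_funM => //.
  exact: (measurableT_comp (measurable_indic mB)).
rewrite indicE; have := p01 w; case: (p w \in B) => pw.
  by rewrite mul1r ger0_norm; lra.
by rewrite mul0r normr0.
Qed.

Let prob_success B : measurable B ->
  P ([set w | Y w = 0] `&` p @^-1` B) =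
  (\int[P]_w (\1_B (p w) * (1 - Y w)))%:E.
Proof.
move=> mB.
have mY0 : measurable [set w | Y w = 0].
  exact: (measurable_funPTI Y (measurable_set1 0)).
have mpB : measurable (p @^-1` B).
  by rewrite -[X in measurable X]setTI; exact: mp.
rewrite -[X in P X]setIT -integral_indic//; last exact: measurableI.
rewrite /Rintegral fineK.
  apply: eq_integral => w _; congr (_%:E); rewrite !indicE.
  rewrite in_setI (_ : (w \in p @^-1` B) = (p w \in B)); last first.
    by apply/idP/idP; rewrite !inE.
  case: (Y01 w) => Yw; rewrite Yw.
    by rewrite (mem_set (_ : [set w | Y w = 0] w))//= subr0 mulr1.
  rewrite (memNset (_ : ~ [set w | Y w = 0] w))/= ?subrr ?mulr0//.
  by rewrite Yw; apply/eqP; exact: oner_neq0.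
apply: integrable_fin_num => //.
apply: (@bounded_integrable _ _ _ P _ 1) => [|w].
  apply: measurable_funM; last exact: measurable_funB.
  exact: (measurableT_comp (measurable_indic mB)).
rewrite indicE; case: (p w \in B); rewrite ?mul1r ?mul0r ?normr0//.
by case: (Y01 w) => ->; rewrite ?subr0 ?subrr ?normr0 ?normr1.
Qed.

Let int_residual B : measurable B ->
  \int[P]_w (\1_B (p w) * D w) =
  \int[P]_w (\1_B (p w) * (1 - Y w)) - \int[P]_w (\1_B (p w) * p w).
Proof.
move=> mB; have mI : measurable_fun setT (fun w => \1_B (p w) : R).
  exact: (measurableT_comp (measurable_indic mB)).
rewrite -RintegralB//.
- by apply: eq_Rintegral => w _; rewrite /D; ring.
- apply: (@bounded_integrable _ _ _ P _ 1) => [|w].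
    by apply: measurable_funM => //; exact: measurable_funB.
  rewrite indicE; case: (p w \in B); rewrite ?mul1r ?mul0r ?normr0//.
  by case: (Y01 w) => ->; rewrite ?subr0 ?subrr ?normr0 ?normr1.
- apply: (@bounded_integrable _ _ _ P _ 1) => [|w].
    exact: measurable_funM.
  rewrite indicE; have := p01 w; case: (p w \in B) => pw.
    by rewrite mul1r ger0_norm; lra.
  by rewrite mul0r normr0.
Qed.

Let p_integrable (A : set T) : measurable A -> P.-integrable A (EFin \o p).
Proof.
move=> mA; apply: (integrableS measurableT) => //.
apply: (@bounded_integrable _ _ _ P _ 1) => // w.
by have := p01 w => pw; rewrite ger0_norm; lra.
Qed.

(** Since p is itself measurable for sigma(p), it is a version of the
    conditional probability as soon as it satisfies the averaging identity over
    the events {p in B}, which is the vanishing of the residual there. *)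
Lemma conditionally_calibratedP :
  conditionally_calibrated P p Y <->
  forall B, measurable B -> \int[P]_w (\1_B (p w) * D w) = 0.
Proof.
split=> [[g [_ ig gE] gp] B mB|h].
  have mpB : measurable (p @^-1` B).
    by rewrite -[X in measurable X]setTI; exact: mp.
  have Bp : g_sigma_algebra_preimage p (p @^-1` B) by exists B; rewrite ?setTI.
  apply/eqP; rewrite int_residual// subr_eq0; apply/eqP/EFin_inj.
  rewrite -prob_success// -gE// -int_forecast//.
  apply: ae_eq_integral => //.
  - by have /integrableP[mg _] := ig; exact: measurable_funS mg.
  - by apply/measurable_EFinP; exact: measurable_funS mp.
  - by apply: filterS gp => w /= -> .
exists p; last exact: aeW.
split; [by []|exact: p_integrable|] => _ [B mB <-]; rewrite setTI.
rewrite int_forecast// prob_success//; congr (_%:E).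
by apply/eqP; rewrite eq_sym -subr_eq0 -int_residual// h.
Qed.

(** Only 0 <= y < 1 carries information; outside, {Y <= y} is empty or full and
    a constant is a version of its conditional probability. *)
Lemma ideal_conditionally_calibrated :
  conditionally_calibrated P p Y <->
  ideal P (g_sigma_algebra_preimage p) (fun w => binary_cdf (p w)) Y.
Proof.
have cst_cond_prob (E : set T) (b : bool) : E = (if b then setT else set0) ->
    is_cond_prob P (g_sigma_algebra_preimage p) E (cst b%:R).
  move=> EE; split.
  - move=> _ [B mB <-]; rewrite setTI preimage_cst.
    by case: ifPn => _; [exists setT|exists set0];
      rewrite ?preimage_setT ?preimage_set0 ?setTI.
  - exact: finite_measure_integrable_cst.
  - move=> _ [B mB <-]; rewrite setTI.
    have mpB : measurable (p @^-1` B).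
      by rewrite -[X in measurable X]setTI; exact: mp.
    transitivity (\int[P]_(w in p @^-1` B) cst (b%:R : R)%:E w)%E => //.
    rewrite integral_cst//.
    by rewrite EE; case: b {EE}; rewrite ?mul1e ?mul0e ?setTI ?set0I ?measure0.
have Y0E y : 0 <= y -> y < 1 -> [set w | Y w <= y] = [set w | Y w = 0].
  move=> y0 y1; apply/seteqP; split=> w /=; last by move=> ->.
  by case: (Y01 w) => ->//; lra.
split=> [[g gP gp] y|/(_ 0)]; last first.
  rewrite /cond_prob_ae_eq Y0E// => -[g gP gp]; exists g => //.
  by apply: filterS gp => w ->; rewrite binary_cdf_lt1.
have [y0|y0] := ltP y 0.
  exists (cst false%:R).
    apply: cst_cond_prob; apply/seteqP; split=> w //=.
    by case: (Y01 w) => ->; lra.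
  by apply: aeW => w; rewrite binary_cdf_lt0.
have [y1|y1] := leP 1 y.
  exists (cst true%:R).
    apply: cst_cond_prob; apply/seteqP; split=> w //= _.
    by case: (Y01 w) => ->; lra.
  by apply: aeW => w; rewrite binary_cdf_ge1.
exists g; first by rewrite Y0E.
by apply: filterS gp => w ->; rewrite binary_cdf_lt1.
Qed.

End binary_prediction_space.

Theorem theorem2p12 (R : realType) (d : measure_display) (T : measurableType d)
    (P : probability T R) (A1 : set (set T)) (p : T -> R) (Y V : {RV P >-> R})
    (hp : forall w, 0 <= p w <= 1)
    (hY : forall w, Y w = 0 \/ Y w = 1)
    (hps : prediction_space A1 (fun w => binary_cdf (p w)) Y V) :
  (probabilistically_calibrated P (fun w => binary_cdf (p w)) Y V
     <-> conditionally_calibrated P p Y) /\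
  (conditionally_calibrated P p Y
     <-> ideal P (g_sigma_algebra_preimage p)
           (fun w => binary_cdf (p w)) Y).
Proof.
split; last exact: ideal_conditionally_calibrated hps.
have mp : measurable_fun setT p by exact: forecast_measurable hps.
have mD : measurable_fun setT (fun w => 1 - Y w - p w).
  by apply: measurable_funB => //; exact: measurable_funB.
have D1 w : `|1 - Y w - p w| <= 1 by exact: residual_le1.
rewrite (conditionally_calibratedP hp hY hps).
rewrite (probabilistically_calibratedP hp hY hps).
split; first exact: pit_kernel_moments_Borel.
exact: Borel_moments_pit_kernel.
Qed.
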